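(* Let $\alpha>0$, let $\boldsymbol{X}$ be a real $n\times p$ data matrix, and let $\boldsymbol{\theta}^\ast=(\lambda^\ast,\{u_i^\ast\}_{i=1}^n,\{v_j^\ast\}_{j=1}^p,(\sigma^\ast)^2)$ be the converged rSVDdpd estimator for $\boldsymbol{X}$, i.e. the limit of the rSVDdpd iteration for $\boldsymbol{X}$ started from an initial estimate $\boldsymbol{\theta}^{(0)}=(\lambda^{(0)},\{u_i^{(0)}\}_{i=1}^n,\{v_j^{(0)}\}_{j=1}^p,(\sigma^{(0)})^2)$. Let $\boldsymbol{P}$ and $\boldsymbol{Q}$ be the permutation matrices corresponding to permutations $\pi_R$ of $\{1,\dots,n\}$ and $\pi_C$ of $\{1,\dots,p\}$ respectively. Then the rSVDdpd iteration for the data matrix $\boldsymbol{P}\boldsymbol{X}\boldsymbol{Q}^\top$ started from the initial estimate $(\lambda^{(0)},\{u_{\pi_R(i)}^{(0)}\}_{i=1}^n,\{v_{\pi_C(j)}^{(0)}\}_{j=1}^p,(\sigma^{(0)})^2)$ converges to $(\lambda^\ast,\{u_{\pi_R(i)}^\ast\}_{i=1}^n,\{v_{\pi_C(j)}^\ast\}_{j=1}^p,(\sigma^\ast)^2)$.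
   Context: Convention: $\boldsymbol{P},\boldsymbol{Q}$ are such that the $(i,j)$ entry of $\boldsymbol{P}\boldsymbol{X}\boldsymbol{Q}^\top$ is $X_{\pi_R(i),\pi_C(j)}$. $f$ is a known differentiable probability density on $\mathbb{R}$ with $f(x)=f(-x)$, $M_f=\int f^{1+\alpha}$, $s(x)=f'(x)/f(x)$, and $\psi(x)=-f^\alpha(|x|)\,s(|x|)/|x|$. Parameter space: $\boldsymbol{\Theta}=(0,\infty)\times S_n^+\times S_p\times[\epsilon,\infty)$, where $\epsilon>0$ is a fixed small number, $S_p$ is the unit sphere of $\mathbb{R}^p$ and $S_n^+=\{x\in\mathbb{R}^n:\sum_ix_i^2=1,\ x_i\ge0\ \forall i\}$. rSVDdpd iteration for a data matrix $\boldsymbol{X}$: starting from $\boldsymbol{\theta}^{(0)}\in\boldsymbol{\Theta}$, the iterates $\boldsymbol{\theta}^{(t)}=(\lambda^{(t)},\{u_i^{(t)}\},\{v_j^{(t)}\},(\sigma^2)^{(t)})\in\boldsymbol{\Theta}$ satisfy, with $e_{ij}^{(t)}=X_{ij}-\lambda^{(t)}u_i^{(t)}v_j^{(t)}$ and $\sigma^{(t)}=\sqrt{(\sigma^2)^{(t)}}$, for $t=0,1,\dots$ $$\lambda^{(t+1)}u_i^{(t+1)}=\frac{\sum_j v_j^{(t)}X_{ij}\,\psi(e_{ij}^{(t)}/\sigma^{(t)})}{\sum_j (v_j^{(t)})^2\,\psi(e_{ij}^{(t)}/\sigma^{(t)})},\qquad \lambda^{(t+1)}v_j^{(t+1)}=\frac{\sum_i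 u_i^{(t+1)}X_{ij}\,\psi(e_{ij}^{(t)}/\sigma^{(t)})}{\sum_i (u_i^{(t+1)})^2\,\psi(e_{ij}^{(t)}/\sigma^{(t)})},$$ $$(\sigma^2)^{(t+1)}=\frac{(np)^{-1}\sum_{i,j}(e_{ij}^{(t)})^2\,\psi(e_{ij}^{(t)}/\sigma^{(t)})}{(np)^{-1}\sum_{i,j}\psi(e_{ij}^{(t)}/\sigma^{(t)})-\frac{\alpha}{1+\alpha}M_f}.$$ The first two rules are each understood with normalization: the right-hand side vector of the first rule is normalized to give the unit vector $u^{(t+1)}$, which is then used in the second rule; the right-hand side vector of the second rule is normalized to give the unit vector $v^{(t+1)}$, the normalizing scalar being $\lambda^{(t+1)}$. *)

(* Defs.v *)
From HB Require Import structures.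
From mathcomp Require Import all_boot all_order all_algebra all_fingroup.
From mathcomp Require Import all_classical all_reals all_analysis.
Set Implicit Arguments. Unset Strict Implicit. Unset Printing Implicit Defensive.
Import Order.TTheory GRing.Theory Num.Theory.
Import numFieldNormedType.Exports.
Local Open Scope classical_set_scope.
Local Open Scope ring_scope.

Definition probability_density (R : realType) (f : R -> R) : Prop :=
  [/\ measurable_fun setT f,
      forall x, 0 <= f x &
      (\int[lebesgue_measure]_(x in setT) (f x)%:E)%E = 1%E].

Definition M_f (R : realType) (f : R -> R) (alpha : R) : R :=
  Rintegral lebesgue_measure setT (fun x => f x `^ (1 + alpha)).

Definition score (R : realType) (f : R -> R) (x : R) : R := derive1 f x / f x.

(* The formula for psi is undefined at x = 0.  Its value there, [c], is a
   parameter, so that no convention (such as division by zero, or extension by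
   continuity) is imposed.  At a zero of f the formula gives 0, because of the
   factor f^alpha with alpha > 0. *)
Definition psi (R : realType) (f : R -> R) (alpha c : R) (x : R) : R :=
  if x == 0 then c else - (f `|x| `^ alpha * score f `|x|) / `|x|.

(* (lambda, u, v, sigma^2); the product carries the product topology. *)
Definition param (R : realType) (n p : nat) : Type :=
  (R * 'cV[R]_n * 'cV[R]_p * R)%type.

Section Rsvddpd.
Variables (R : realType) (n p : nat).
Implicit Types (theta : param R n p) (X : 'M[R]_(n, p)).

Definition lambda_of theta : R := theta.1.1.1.
Definition u_of theta : 'cV[R]_n := theta.1.1.2.
Definition v_of theta : 'cV[R]_p := theta.1.2.
Definition sigma2_of theta : R := theta.2.

(* The library norm on matrices is the maximum norm. *)
Definition l2norm (m : nat) (x : 'cV[R]_m) : R :=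
  Num.sqrt (\sum_i x i 0 ^+ 2).

Definition unit_sphere (m : nat) : set 'cV[R]_m :=
  [set x | \sum_i x i 0 ^+ 2 = 1].

Definition nonneg_unit_sphere (m : nat) : set 'cV[R]_m :=
  [set x | \sum_i x i 0 ^+ 2 = 1 /\ forall i, 0 <= x i 0].

Definition Theta (eps : R) : set (param R n p) :=
  [set theta | [/\ 0 < lambda_of theta,
                   nonneg_unit_sphere (u_of theta),
                   unit_sphere (v_of theta) &
                   eps <= sigma2_of theta]].

Variables (f : R -> R) (alpha c : R).

Definition residual X theta (i : 'I_n) (j : 'I_p) : R :=
  X i j - lambda_of theta * u_of theta i 0 * v_of theta j 0.

Definition weight X theta (i : 'I_n) (j : 'I_p) : R :=
  psi f alpha c (residual X theta i j / Num.sqrt (sigma2_of theta)).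

Definition u_denom X theta (i : 'I_n) : R :=
  \sum_j v_of theta j 0 ^+ 2 * weight X theta i j.

Definition u_raw X theta : 'cV[R]_n :=
  \col_i ((\sum_j v_of theta j 0 * X i j * weight X theta i j)
          / u_denom X theta i).

Definition u_next X theta : 'cV[R]_n :=
  (l2norm (u_raw X theta))^-1 *: u_raw X theta.

Definition v_denom X theta (j : 'I_p) : R :=
  \sum_i u_next X theta i 0 ^+ 2 * weight X theta i j.

Definition v_raw X theta : 'cV[R]_p :=
  \col_j ((\sum_i u_next X theta i 0 * X i j * weight X theta i j)
          / v_denom X theta j).

Definition lambda_next X theta : R := l2norm (v_raw X theta).

Definition v_next X theta : 'cV[R]_p :=
  (lambda_next X theta)^-1 *: v_raw X theta.

Definition sigma2_denom X theta : R :=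
  (n * p)%:R^-1 * (\sum_i \sum_j weight X theta i j)
  - alpha / (1 + alpha) * M_f f alpha.

Definition sigma2_next X theta : R :=
  ((n * p)%:R^-1 *
     (\sum_i \sum_j residual X theta i j ^+ 2 * weight X theta i j))
  / sigma2_denom X theta.

Definition rSVDdpd_step X theta : param R n p :=
  (lambda_next X theta, u_next X theta, v_next X theta, sigma2_next X theta).

Definition rSVDdpd_iterate X theta (t : nat) : param R n p :=
  iter t (rSVDdpd_step X) theta.

Definition step_defined X theta : Prop :=
  [/\ forall i, u_denom X theta i != 0,
      forall j, v_denom X theta j != 0 &
      sigma2_denom X theta != 0].

(* Division is total here, so the iteration is required to make sense: every
   iterate lies in Theta and no update divides by zero.  (The two norms used
   for normalization are then nonzero as well, since u and v are unit.) *)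
Definition rSVDdpd_converges (eps : R) X
    (theta0 theta_star : param R n p) : Prop :=
  (forall t, Theta eps (rSVDdpd_iterate X theta0 t) /\
             step_defined X (rSVDdpd_iterate X theta0 t)) /\
  rSVDdpd_iterate X theta0 t @[t --> \oo] --> theta_star.

Definition permute_param (piR : 'S_n) (piC : 'S_p) theta : param R n p :=
  (lambda_of theta, \col_i u_of theta (piR i) 0, \col_j v_of theta (piC j) 0,
   sigma2_of theta).

End Rsvddpd.

(* [perm_mx] follows the convention that the (i, j) entry of P X Q^T is
   X (piR i) (piC j). *)
Lemma perm_mx_mul_trE (R : realType) (n p : nat) (X : 'M[R]_(n, p))
    (piR : 'S_n) (piC : 'S_p) i j :
  (perm_mx piR *m X *m (perm_mx piC)^T) i j = X (piR i) (piC j).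
Proof. by rewrite tr_perm_mx -row_permE -col_permE !mxE. Qed.

(* Main.v *)
Require Import Defs.
From HB Require Import structures.
From mathcomp Require Import all_boot all_order all_algebra all_fingroup.
From mathcomp Require Import all_classical all_reals all_analysis.
Set Implicit Arguments. Unset Strict Implicit. Unset Printing Implicit Defensive.
Import Order.TTheory GRing.Theory Num.Theory.
Import numFieldNormedType.Exports.
Local Open Scope classical_set_scope.
Local Open Scope ring_scope.

(** The iteration is equivariant under relabelling rows and columns. The data
    entry, the residual and hence the weight at position (i, j) of the permuted
    problem are those at (piR i, piC j) of the original one. Every other
    ingredient of an update is a sum over all rows, all columns or all entries,
    and a sum over a finite index set is unchanged when the index set is
    permuted. So numerators and denominators of the u-rule (v-rule) are those of
    the original problem with the index relabelled by piR (piC), while the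
    normalizing norms and sigma^2 are unchanged. The v-rule reads the freshly
    updated u, which has by then been relabelled by piR in the same way as the
    old one, so its sums over rows are again merely reordered. Thus one step
    commutes with [permute_param] ([rSVDdpd_step_permute]), and by induction all
    iterates do ([rSVDdpd_iterate_permute]).

    Convergence transfers because relabelling coordinates is continuous
    ([permute_param_continuous]); that the iteration stays well defined
    transfers because the sphere constraints and the vanishing of denominators
    are invariant under relabelling. *)

Lemma sum_perm (V : nmodType) (m : nat) (s : 'S_m) (F : 'I_m -> V) :
  \sum_i F (s i) = \sum_i F i.
Proof. by rewrite [RHS](reindex_inj (@perm_inj _ s)). Qed.

Lemma l2norm_row_perm (R : realType) (m : nat) (s : 'S_m) (x : 'cV[R]_m) :
  l2norm (row_perm s x) = l2norm x.
Proof.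
rewrite /l2norm; congr Num.sqrt; under eq_bigr do rewrite mxE.
exact: (sum_perm s (fun i => x i 0 ^+ 2)).
Qed.

(** Basic neighbourhoods of a matrix are products of neighbourhoods of its
    entries, and permuting the rows permutes the factors. *)
Lemma row_perm_continuous (T : topologicalType) (m k : nat) (s : 'S_m) :
  continuous (row_perm s : 'M[T]_(m, k) -> 'M[T]_(m, k)).
Proof.
move=> M A [P nbhsP PA]; exists (fun i j => P (s^-1%g i) j) => [i j|N PN].
  by have := nbhsP (s^-1%g i) j; rewrite mxE permKV.
by apply: PA => i j; have := PN (s i) j; rewrite permK mxE.
Qed.

Lemma pair_map_continuous (T U T' U' : topologicalType)
    (g : T -> T') (h : U -> U') :
  continuous g -> continuous h -> continuous (fun q : T * U => (g q.1, h q.2)).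
Proof.
move=> g_cont h_cont [x y] A [[P Q] [nbhsP nbhsQ] PQA].
exists (g @^-1` P, h @^-1` Q) => [|q [Pq Qq]]; last exact: PQA.
by split; [exact: g_cont | exact: h_cont].
Qed.

Section Permutation.
Variables (R : realType) (n p : nat) (piR : 'S_n) (piC : 'S_p).

Local Notation permute := (permute_param piR piC).

Lemma permute_paramE (theta : param R n p) :
  permute theta = (lambda_of theta, row_perm piR (u_of theta),
                   row_perm piC (v_of theta), sigma2_of theta).
Proof.
rewrite /permute_param; congr (_, _, _, _); apply/matrixP => i j;
  by rewrite !mxE ord1.
Qed.

Lemma permute_param_continuous :
  continuous (permute : param R n p -> param R n p).
Proof.
rewrite (funext permute_paramE).
apply: (@pair_map_continuous _ _ _ _
  (fun q => (q.1.1, row_perm piR q.1.2, row_perm piC q.2)) id);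
  last by move=> x; exact: cvg_id.
apply: (@pair_map_continuous _ _ _ _ (fun q => (q.1, row_perm piR q.2)) _).
  by apply: (@pair_map_continuous _ _ _ _ id) => [x|];
    [exact: cvg_id | exact: row_perm_continuous].
exact: row_perm_continuous.
Qed.

Lemma Theta_permute (eps : R) (theta : param R n p) :
  Theta eps theta -> Theta eps (permute theta).
Proof.
have sum_sq m (s : 'S_m) (x : 'cV[R]_m) :
    \sum_i (\col_i x (s i) 0) i 0 ^+ 2 = \sum_i x i 0 ^+ 2.
  under eq_bigr do rewrite mxE.
  exact: (sum_perm s (fun i => x i 0 ^+ 2)).
case=> lambda_gt0 [u_unit u_ge0] v_unit sigma2_ge; split=> //=.
- by split=> [|i]; rewrite ?sum_sq // mxE.
- by rewrite /unit_sphere /= sum_sq.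
Qed.

Variables (f : R -> R) (alpha c : R) (X : 'M[R]_(n, p)).

Local Notation permX := (perm_mx piR *m X *m (perm_mx piC)^T).

Section Step.
Variable theta : param R n p.

Lemma residual_permute i j :
  residual permX (permute theta) i j = residual X theta (piR i) (piC j).
Proof. by rewrite /residual perm_mx_mul_trE !mxE. Qed.

Lemma weight_permute i j :
  weight f alpha c permX (permute theta) i j
  = weight f alpha c X theta (piR i) (piC j).
Proof. by rewrite /weight residual_permute. Qed.

Lemma u_denom_permute i :
  u_denom f alpha c permX (permute theta) i
  = u_denom f alpha c X theta (piR i).
Proof.
rewrite /u_denom -[RHS](sum_perm piC).
by apply: eq_bigr => j _; rewrite weight_permute mxE.
Qed.

Lemma u_raw_permute :
  u_raw f alpha c permX (permute theta) = row_perm piR (u_raw f alpha c X theta).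
Proof.
apply/matrixP => i k; rewrite !mxE u_denom_permute; congr (_ / _).
rewrite -[RHS](sum_perm piC).
by apply: eq_bigr => j _; rewrite weight_permute perm_mx_mul_trE mxE.
Qed.

Lemma u_next_permute :
  u_next f alpha c permX (permute theta)
  = row_perm piR (u_next f alpha c X theta).
Proof.
rewrite /u_next u_raw_permute l2norm_row_perm.
by apply/matrixP => i k; rewrite !mxE.
Qed.

Lemma v_denom_permute j :
  v_denom f alpha c permX (permute theta) j
  = v_denom f alpha c X theta (piC j).
Proof.
rewrite /v_denom u_next_permute -[RHS](sum_perm piR).
by apply: eq_bigr => i _; rewrite weight_permute mxE.
Qed.

Lemma v_raw_permute :
  v_raw f alpha c permX (permute theta) = row_perm piC (v_raw f alpha c X theta).
Proof.
apply/matrixP => j k; rewrite !mxE v_denom_permute; congr (_ / _).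
rewrite u_next_permute -[RHS](sum_perm piR); apply: eq_bigr => i _.
by rewrite weight_permute perm_mx_mul_trE [row_perm _ _ _ _]mxE.
Qed.

Lemma lambda_next_permute :
  lambda_next f alpha c permX (permute theta) = lambda_next f alpha c X theta.
Proof. by rewrite /lambda_next v_raw_permute l2norm_row_perm. Qed.

Lemma v_next_permute :
  v_next f alpha c permX (permute theta)
  = row_perm piC (v_next f alpha c X theta).
Proof.
rewrite /v_next lambda_next_permute v_raw_permute.
by apply/matrixP => j k; rewrite !mxE.
Qed.

Lemma sigma2_denom_permute :
  sigma2_denom f alpha c permX (permute theta) = sigma2_denom f alpha c X theta.
Proof.
rewrite /sigma2_denom -[in RHS](sum_perm piR); congr (_ * _ - _).
apply: eq_bigr => i _; rewrite -[RHS](sum_perm piC).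
by apply: eq_bigr => j _; rewrite weight_permute.
Qed.

Lemma sigma2_next_permute :
  sigma2_next f alpha c permX (permute theta) = sigma2_next f alpha c X theta.
Proof.
rewrite /sigma2_next sigma2_denom_permute -[in RHS](sum_perm piR).
congr (_ * _ / _); apply: eq_bigr => i _; rewrite -[RHS](sum_perm piC).
by apply: eq_bigr => j _; rewrite residual_permute weight_permute.
Qed.

Lemma rSVDdpd_step_permute :
  rSVDdpd_step f alpha c permX (permute theta)
  = permute (rSVDdpd_step f alpha c X theta).
Proof.
rewrite [RHS]permute_paramE /rSVDdpd_step.
by rewrite lambda_next_permute u_next_permute v_next_permute sigma2_next_permute.
Qed.

Lemma step_defined_permute :
  step_defined f alpha c X theta ->
  step_defined f alpha c permX (permute theta).
Proof.
case=> u_neq0 v_neq0 sigma2_neq0; split=> [i|j|].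
- by rewrite u_denom_permute.
- by rewrite v_denom_permute.
- by rewrite sigma2_denom_permute.
Qed.

End Step.

Lemma rSVDdpd_iterate_permute (theta : param R n p) (t : nat) :
  rSVDdpd_iterate f alpha c permX (permute theta) t
  = permute (rSVDdpd_iterate f alpha c X theta t).
Proof.
rewrite /rSVDdpd_iterate; elim: t => //= t ->.
exact: rSVDdpd_step_permute.
Qed.

End Permutation.

Theorem theorem3p7 (R : realType) (n p : nat)
    (f : R -> R) (alpha eps c : R)
    (alpha_gt0 : 0 < alpha) (eps_gt0 : 0 < eps)
    (f_density : probability_density f)
    (f_derivable : forall x : R, derivable f x 1)
    (f_even : forall x : R, f x = f (- x))
    (X : 'M[R]_(n, p)) (theta0 theta_star : param R n p)
    (piR : 'S_n) (piC : 'S_p)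
    (theta_cvg : rSVDdpd_converges f alpha c eps X theta0 theta_star) :
  rSVDdpd_converges f alpha c eps
    (perm_mx piR *m X *m (perm_mx piC)^T)
    (permute_param piR piC theta0) (permute_param piR piC theta_star).
Proof.
case: theta_cvg => theta_ok theta_lim.
split=> [t|]; last rewrite (funext (rSVDdpd_iterate_permute _ _ _ _ _ _ _)).
  rewrite rSVDdpd_iterate_permute; have [inTheta defined] := theta_ok t.
  by split; [exact: Theta_permute | exact: step_defined_permute].
by apply: continuous_cvg theta_lim; exact: permute_param_continuous.
Qed.
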